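(* Let $X(\mathbb{C})\subset \mathbb{P}^{n+1}(\mathbb{C})$ be an integral and non-degenerate hypersurface defined over $\mathbb{R}$. Then every $q\in \mathbb{P}^{n+1}(\mathbb{R})$ has either $(1,0)$ or $(0,2)$ or $(0,1)$ as a label (with respect to $X(\mathbb{C})$).
   Context: Let $\sigma:\mathbb{P}^{r}(\mathbb{C})\to\mathbb{P}^{r}(\mathbb{C})$ be complex conjugation (here $r=n+1$), so $\mathbb{P}^{r}(\mathbb{R})=\{x\in\mathbb{P}^{r}(\mathbb{C})\mid\sigma(x)=x\}$. An integral (irreducible and reduced) closed subvariety $X(\mathbb{C})\subset\mathbb{P}^{r}(\mathbb{C})$ is defined over $\mathbb{R}$ if $\sigma(X(\mathbb{C}))=X(\mathbb{C})$; then $X(\mathbb{R}):=X(\mathbb{C})\cap\mathbb{P}^{r}(\mathbb{R})$. Non-degenerate means not contained in a hyperplane (for a hypersurface: of degree at least $2$). A label is a pair $(a,b)\in\mathbb{N}^2\setminus\{(0,0)\}$; its weight is $2a+b$. A finite non-empty set $S\subset X(\mathbb{C})$ has label $(a,b)$ if $\sigma(S)=S$, $b=|S\cap X(\mathbb{R})|$ and $|S|=2a+b$. For finite $S\subset X(\mathbb{C})$, $\langle S\rangle_{\mathbb{C}}$ is the minimal complex linear subspace of $\mathbb{P}^{r}(\mathbb{C})$ containing $S$ and $\langle S\rangle_{\mathbb{R}}:=\langle S\rangle_{\mathbb{C}}\cap\mathbb{P}^{r}(\mathbb{R})$. A point $q\in\mathbb{P}^{r}(\mathbb{R})$ has $(a,b)$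 as a label if there is a finite set $S\subset X(\mathbb{C})$ with label $(a,b)$ and $q\in\langle S\rangle_{\mathbb{R}}$. *)

(* Defs.v *)
From HB Require Import structures.
From mathcomp Require Import all_boot all_order all_algebra.
From mathcomp Require Import finmap complex mpoly.
From mathcomp Require Import classical_sets reals.

Set Implicit Arguments.
Unset Strict Implicit.
Unset Printing Implicit Defensive.

Import GRing.Theory.

Local Open Scope ring_scope.
Local Open Scope complex_scope.
Local Open Scope classical_set_scope.

(* Points of P^r(K) are the lines through 0 in K^(r+1). *)
Record pspace (K : fieldType) (r : nat) := PSpace {
  pline :> {vspace 'rV[K]_r.+1};
  dim_pline : \dim pline == 1%N }.

HB.instance Definition _ (K : fieldType) (r : nat) :=
  [isSub for @pline K r].
HB.instance Definition _ (K : fieldType) (r : nat) :=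
  [Choice of pspace K r by <:].

Section ProjectiveGeometry.
Variables (K : fieldType) (r : nat).
Implicit Types (x q : pspace K r) (f : {mpoly K[r.+1]}) (X : set (pspace K r)).

Lemma dim_vline_neq0 (v : 'rV[K]_r.+1) : v != 0 -> \dim <[v]>%VS == 1%N.
Proof. by move=> v_neq0; rewrite dim_vline v_neq0. Qed.

Definition ppoint (v : 'rV[K]_r.+1) (v_neq0 : v != 0) : pspace K r :=
  PSpace (dim_vline_neq0 v_neq0).

Lemma vpick_pline_neq0 x : vpick x != 0.
Proof. by rewrite vpick0 -dimv_eq0 (eqP (dim_pline x)). Qed.

Lemma plineE x (v : 'rV[K]_r.+1) :
  v \in pline x -> v != 0 -> pline x = <[v]>%VS.
Proof.
move=> vx v_neq0; apply/esym/eqP.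
by rewrite eqEdim -memvE vx dim_vline v_neq0 (eqP (dim_pline x)).
Qed.

(* For f homogeneous, this does not depend on the representative v != 0. *)
Definition vanishes f x :=
  forall v : 'rV[K]_r.+1, v \in pline x -> f.@[v ord0] = 0.

Definition zero_locus (F : set {mpoly K[r.+1]}) : set (pspace K r) :=
  [set x | forall f, F f -> vanishes f x].

Definition zariski_closed X :=
  exists F : set {mpoly K[r.+1]},
    (forall f, F f -> exists d, f \is d.-homog) /\ X = zero_locus F.

(* A closed subset carries its reduced structure, so that integral closed
   subvarieties are the same as irreducible closed subsets. *)
Definition integral_subvariety X :=
  [/\ zariski_closed X, X !=set0 &
      forall A B, zariski_closed A -> zariski_closed B ->
        X `<=` A `|` B -> X `<=` A \/ X `<=` B].

Definition hypersurface X :=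
  exists d (f : {mpoly K[r.+1]}),
    [/\ (0 < d)%N, f != 0, f \is d.-homog & X = zero_locus [set f]].

(* The projective linear subspace P(W), of projective dimension \dim W - 1. *)
Definition plinear (W : {vspace 'rV[K]_r.+1}) : set (pspace K r) :=
  [set x | (pline x <= W)%VS].

Definition nondegenerate_subvariety X :=
  ~ exists W : {vspace 'rV[K]_r.+1}, \dim W = r /\ X `<=` plinear W.

Definition pspan (S : {fset pspace K r}) : set (pspace K r) :=
  \bigcap_(W in [set W | [set` S] `<=` plinear W]) plinear W.

End ProjectiveGeometry.

Section RealStructure.
Variables (R : realType) (r : nat).
Implicit Types (x q : pspace R[i] r) (X : set (pspace R[i] r)).
Implicit Types (S : {fset pspace R[i] r}).

Lemma conj_vpick_neq0 x : map_mx (@conjc R) (vpick x) != 0.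
Proof. by rewrite map_mx_eq0 vpick_pline_neq0. Qed.

Definition pconj x : pspace R[i] r := ppoint (conj_vpick_neq0 x).

Lemma pconjE x (v : 'rV[R[i]]_r.+1) : v \in pline x -> v != 0 ->
  pline (pconj x) = <[map_mx (@conjc R) v]>%VS.
Proof.
move=> vx v_neq0; apply: plineE; last by rewrite map_mx_eq0.
have: v \in <[vpick x]>%VS.
  by rewrite -(plineE (memv_pick x) (vpick_pline_neq0 x)).
by case/vlineP=> c ->; rewrite map_mxZ rpredZ ?memv_line.
Qed.

Definition preal : set (pspace R[i] r) := [set x | pconj x = x].

Definition defined_over_R X := pconj @` X = X.

Definition real_points X := X `&` preal.

Definition pspan_R S := pspan S `&` preal.

Definition has_label_set X S (a b : nat) :=
  [/\ (a, b) <> (0%N, 0%N), S <> fset0 & [set` S] `<=` X] /\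
  [/\ pconj @` [set` S] = [set` S],
      b = #|` [fset x in S | x \in real_points X]%fset| &
      #|` S| = (2 * a + b)%N].

Definition has_label X q (a b : nat) :=
  exists S, has_label_set X S a b /\ pspan_R S q.

End RealStructure.

Arguments preal {R r}.

(* Main.v *)
Require Import Defs.
From HB Require Import structures.
From mathcomp Require Import all_boot all_order all_algebra.
From mathcomp Require Import finmap complex mpoly.
From mathcomp Require Import boolp classical_sets reals.
From mathcomp Require Import ring.

(** Let q be a real point off X = {f = 0}, with f homogeneous of degree d. If
    for some real vector w the polynomial f(w + t q) in t has two distinct
    roots, then either one of them is not real and it gives, together with its
    conjugate, a set of label (1,0), or both are real and give the label (0,2).
    Otherwise f(w + t q) = f(q) (t - t_w)^d for all real w. The coefficient of
    t^(d-1), that is the derivative of f at q along w, is linear in w, and it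
    equals - d f(q) t_w. So t_w is a linear form in w, f is a constant times the
    d-th power of this form, and X is a hyperplane. *)

Set Implicit Arguments.
Unset Strict Implicit.
Unset Printing Implicit Defensive.

Import GRing.Theory Num.Theory.

Local Open Scope ring_scope.
Local Open Scope complex_scope.
Local Open Scope classical_set_scope.

(** * Homogeneous polynomials restricted to lines, and their directional derivatives *)

Lemma dhomog_mevalZ (K : comNzRingType) (n d : nat) (f : {mpoly K[n]})
    (c : K) (v : 'rV[K]_n) :
  f \is d.-homog -> f.@[(c *: v) ord0] = c ^+ d * f.@[v ord0].
Proof.
move=> /dhomogP f_homog; rewrite !mevalE mulr_sumr !big_seq.
apply: eq_bigr => m /f_homog /= <-; rewrite mulrCA; congr (_ * _).
rewrite mdegE -prodrXr -big_split /=.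
by apply: eq_bigr => i _; rewrite mxE exprMn.
Qed.

Definition line_poly (K : comNzRingType) (n : nat) (f : {mpoly K[n]})
    (u v : 'rV[K]_n) : {poly K} :=
  mmap polyC (fun i => (u ord0 i)%:P + v ord0 i *: 'X) f.

Lemma horner_line_poly (K : comNzRingType) (n : nat) (f : {mpoly K[n]})
    (u v : 'rV[K]_n) (t : K) :
  (line_poly f u v).[t] = f.@[(u + t *: v) ord0].
Proof.
rewrite /line_poly /mmap mevalE horner_sum; apply: eq_bigr => m _.
rewrite hornerM hornerC /mmap1 horner_prod; congr (_ * _).
by apply: eq_bigr => i _; rewrite !hornerE !mxE mulrC.
Qed.

(** The type [K^o] views the scalars as a module, so that this can be registered as a linear form in
    [v]. *)
Definition dir_deriv (K : comNzRingType) (n : nat) (f : {mpoly K[n]})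
    (u v : 'rV[K]_n) : K^o :=
  (line_poly f u v)^`().[0].

(** The predicate [P] below (value at 0 independent of [v], derivative at 0 linear in [v]) is stable
    under products by the Leibniz rule, and each coordinate [h v i] satisfies it. Hence so do the
    monomials, and then their linear combination [f]. *)
Lemma dir_deriv_is_linear (K : comNzRingType) (n : nat) (f : {mpoly K[n]})
    (u : 'rV[K]_n) : linear (dir_deriv f u).
Proof.
pose h (v : 'rV[K]_n) i : {poly K} := (u ord0 i)%:P + v ord0 i *: 'X.
pose P (g : 'rV[K]_n -> {poly K}) :=
  (forall v w, (g v).[0] = (g w).[0]) /\
  forall (a : K) v w,
    (g (a *: v + w))^`().[0] = a * (g v)^`().[0] + (g w)^`().[0].
have PM g1 g2 : P g1 -> P g2 -> P (fun v => g1 v * g2 v).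
  move=> [g1c g1l] [g2c g2l]; split=> [v w|a v w].
    by rewrite !hornerM (g1c v w) (g2c v w).
  rewrite !derivM !hornerD !hornerM g1l g2l.
  rewrite (g1c (a *: v + w) w) (g1c v w) (g2c (a *: v + w) w) (g2c v w).
  by ring.
have P1 : P (fun=> 1).
  by split=> [v w|a v w] //; rewrite -[1]/(1%:P) derivC horner0 mulr0 addr0.
have PX g k : P g -> P (fun v => g v ^+ k).
  move=> Pg; elim: k => [|k IHk]; first exact: P1.
  have [M0 M1] := PM _ _ Pg IHk.
  by split=> [v w|a v w]; rewrite !exprS; [exact: M0|exact: M1].
have Ph i : P (h^~ i).
  split=> [v w|a v w]; first by rewrite !hornerE.
  by rewrite /h !derivD !derivC !derivZ !derivX !hornerE /= !mxE mulr1 addr0.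
suff [_ Pf] : P (fun v => line_poly f u v) by move=> a v w; apply: Pf.
have Pm m : P (fun v => mmap1 (h v) m).
  rewrite /mmap1; elim: (index_enum _) => [|i s IHs].
    have [M0 M1] := P1.
    by split=> [v w|a v w]; rewrite !big_nil; [exact: M0|exact: M1].
  have [M0 M1] := PM _ _ (PX _ (m i) (Ph i)) IHs.
  by split=> [v w|a v w]; rewrite !big_cons; [exact: M0|exact: M1].
split=> [v w|a v w]; rewrite /line_poly /mmap.
  rewrite !horner_sum; apply: eq_bigr => m _; rewrite !hornerM.
  by rewrite (proj1 (Pm m) v w).
rewrite !(raddf_sum (@deriv K)) !horner_sum mulr_sumr -big_split.
apply: eq_bigr => m _ /=.
rewrite !derivM derivC !mul0r !add0r !hornerM !hornerC (proj2 (Pm m)).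
by rewrite mulrDr mulrCA.
Qed.

HB.instance Definition _ (K : comNzRingType) (n : nat) (f : {mpoly K[n]})
    (u : 'rV[K]_n) :=
  GRing.isLinear.Build K 'rV[K]_n K^o _ (dir_deriv f u)
    (dir_deriv_is_linear f u).

(** In characteristic 0 the naturals give the difference more roots than its degree. Over the
    complex numbers these test points are real, which serves to extend identities from real to
    complex vectors. *)
Lemma poly_eq_nat (K : numDomainType) (p q : {poly K}) :
  (forall k : nat, p.[k%:R] = q.[k%:R]) -> p = q.
Proof.
move=> pq; apply/eqP; rewrite -subr_eq0; apply/eqP.
apply: (@roots_geq_poly_eq0 _ _ [seq k%:R | k <- iota 0 (size (p - q))]).
- apply/allP => _ /mapP[k _ ->].
  by rewrite rootE hornerD hornerN pq subrr.
- by rewrite map_inj_uniq ?iota_uniq // => i j /eqP; rewrite eqr_nat => /eqP.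
- by rewrite size_map size_iota.
Qed.

(** As [u + s v = s (v + s^-1 u)], exchanging base point and direction reverses the polynomial. This
    links the roots on the line to the expansion of [f] around the direction vector. *)
Lemma dhomog_line_polyV (K : fieldType) (n d : nat) (f : {mpoly K[n]})
    (u v : 'rV[K]_n) (s : K) :
  f \is d.-homog -> s != 0 ->
  (line_poly f u v).[s] = s ^+ d * (line_poly f v u).[s^-1].
Proof.
move=> f_homog s0; rewrite !horner_line_poly -dhomog_mevalZ //.
by rewrite scalerDr scalerA mulfV // scale1r addrC.
Qed.

(** Over a closed field a polynomial with at most one root is [c (X - t0)^e]. Reversing it gives
    [f(q) (1 - t0 X)^d] for the line through [q] in direction [w], whose derivative at 0 is the
    stated one. *)
Lemma dhomog_single_root (K : numClosedFieldType) (n d : nat)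
    (f : {mpoly K[n]}) (q w : 'rV[K]_n) :
  f \is d.-homog -> f.@[q ord0] != 0 ->
  (forall t1 t2, root (line_poly f w q) t1 -> root (line_poly f w q) t2 ->
     t1 = t2) ->
  exists2 t0, line_poly f w q = f.@[q ord0] *: ('X - t0%:P) ^+ d &
    dir_deriv f q w = - (d%:R * f.@[q ord0] * t0).
Proof.
move=> f_homog fq0 root_uniq.
set P := line_poly f w q in root_uniq *; set p := line_poly f q w.
have [c [t0 [e PE]]] : exists c t0 e, P = c *: ('X - t0%:P) ^+ e.
  have [rs rsE] := closed_field_poly_normal P.
  have [P0|Pn0] := eqVneq P 0.
    by exists 0, 0, 0%N; rewrite scale0r.
  have rsP z : z \in rs -> root P z.
    by move=> zrs; rewrite rsE rootZ ?lead_coef_eq0 // root_prod_XsubC.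
  (* If [rs] is empty, the exponent is 0 and the default root 0 does no harm. *)
  exists (lead_coef P), (head 0 rs), (size rs); rewrite {1}rsE; congr (_ *: _).
  rewrite big_tnth -[X in _ ^+ X]card_ord -prodr_const.
  apply: eq_bigr => i _; congr ('X - _%:P); apply: root_uniq.
    exact/rsP/mem_tnth.
  apply/rsP; case: (rs) i => [[]//|z s _]; exact: mem_head.
have pX (s : K) : s != 0 -> s ^+ e * p.[s] = c * s ^+ d * (1 - s * t0) ^+ e.
  move=> s0; rewrite (dhomog_line_polyV _ _ f_homog s0) -/P PE.
  have -> : 1 - s * t0 = s * (s^-1 - t0) by rewrite mulrBr mulfV.
  by rewrite hornerZ horner_exp hornerXsubC exprMn; ring.
(* The factor 'X makes the identity hold at 0 as well. *)
have pE : 'X ^+ e * p * 'X = c *: 'X ^+ d * (1 - t0 *: 'X) ^+ e * 'X.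
  apply: poly_eq_nat => k; rewrite !hornerMX.
  have [->|k0] := eqVneq (k%:R : K) 0; first by rewrite !mulr0.
  congr (_ * _); move: (pX _ k0); rewrite !(hornerE, horner_exp) => ->.
  by rewrite [t0 * _]mulrC.
have {}pE := mulIf (negbT (polyX_eq0 K)) pE.
have p0 : p.[0] = f.@[q ord0] by rewrite horner_line_poly scale0r addr0.
have Xn0 k : 'X^k != 0 :> {poly K} by rewrite expf_neq0 ?polyX_eq0.
(* This excludes [P = 0], recorded above with [c = 0]: by [pE] it would give [p = 0], hence
   [f(q) = p(0) = 0]. *)
have c0 : c != 0.
  apply: contraNneq fq0 => c0; move/eqP: pE; rewrite c0 scale0r mul0r.
  by rewrite mulf_eq0 (negbTE (Xn0 _)) /= -p0 => /eqP ->; rewrite horner0.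
(* Both sides of pE have the same order of vanishing at 0. *)
have de : d = e.
  case: (ltngtP d e) => // lt; [case/eqP: c0 | case/eqP: fq0].
    move: pE; rewrite -{1}(subnK (ltnW lt)) addnC exprD -scalerAl scalerAr.
    rewrite -mulrA => /(mulfI (Xn0 _))/(congr1 (horner^~ 0)).
    rewrite hornerM hornerXn expr0n subn_eq0 leqNgt lt mul0r.
    by rewrite !(hornerE, horner_exp) subr0 expr1n mulr1 => <-.
  move: pE; rewrite -{1}(subnK (ltnW lt)) addnC exprD -scalerAl -mulrA scalerAr.
  move=> /(mulfI (Xn0 _))/(congr1 (horner^~ 0)); rewrite p0 => ->.
  by rewrite hornerZ hornerM hornerXn expr0n subn_eq0 leqNgt lt mul0r mulr0.
rewrite -de in pE PE.
have {}pE : p = c *: (1 - t0 *: 'X) ^+ d.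
  by move: pE; rewrite -scalerAl scalerAr => /(mulfI (Xn0 _)).
have cE : c = f.@[q ord0].
  by rewrite -p0 pE !(hornerE, horner_exp) subr0 expr1n mulr1.
exists t0; first by rewrite PE cE.
rewrite /dir_deriv -/p pE derivZ deriv_exp -cE derivB derivZ derivX.
rewrite -[1]/(1%:P) derivC !(hornerE, horner_exp) hornerMn.
rewrite !(hornerE, horner_exp) subr0 expr1n.
ring.
Qed.

(** Euler's identity, read off from [f(q + t q) = (1 + t)^d f(q)]. *)
Lemma dir_deriv_self (K : numDomainType) (n d : nat) (f : {mpoly K[n]})
    (q : 'rV[K]_n) :
  f \is d.-homog -> dir_deriv f q q = d%:R * f.@[q ord0].
Proof.
move=> f_homog; have lineE : line_poly f q q = f.@[q ord0] *: (1 + 'X) ^+ d.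
  apply: poly_eq_nat => k; rewrite horner_line_poly -{1}[q]scale1r -scalerDl.
  by rewrite (dhomog_mevalZ _ _ f_homog) !(hornerE, horner_exp) mulrC.
rewrite /dir_deriv lineE derivZ deriv_exp derivD derivX -[1]/(1%:P) derivC.
by rewrite !(hornerE, horner_exp) hornerMn !(hornerE, horner_exp) ?expr1n mulrC.
Qed.

(** Eliminating [t0] between [f(w) = f(q) (- t0)^d] and the formula for the derivative leaves an
    identity that is polynomial in [w]. *)
Lemma dhomog_single_root_power (K : numClosedFieldType) (n d : nat)
    (f : {mpoly K[n]}) (q w : 'rV[K]_n) :
  f \is d.-homog -> f.@[q ord0] != 0 ->
  (forall t1 t2, root (line_poly f w q) t1 -> root (line_poly f w q) t2 ->
     t1 = t2) ->
  f.@[w ord0] * (d%:R * f.@[q ord0]) ^+ d =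
  f.@[q ord0] * dir_deriv f q w ^+ d.
Proof.
move=> f_homog fq0 /(dhomog_single_root f_homog fq0)[t0 lineE ->].
have -> : f.@[w ord0] = (line_poly f w q).[0].
  by rewrite horner_line_poly scale0r addr0.
rewrite lineE hornerZ horner_exp hornerXsubC sub0r.
by rewrite [_ * t0]mulrC -mulNr [in RHS]exprMn mulrA.
Qed.

(** * Points, lines and spans in projective space *)

Lemma vanishes_ppoint (K : fieldType) (r d : nat) (f : {mpoly K[r.+1]})
    (x : pspace K r) (v : 'rV[K]_r.+1) :
  f \is d.-homog -> v \in pline x -> v != 0 -> f.@[v ord0] = 0 -> vanishes f x.
Proof.
move=> f_homog vx v0 fv u; rewrite (plineE vx v0) => /vlineP[c ->].
by rewrite (dhomog_mevalZ _ _ f_homog) fv mulr0.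
Qed.

Lemma pspace_eq (K : fieldType) (r : nat) (x y : pspace K r) v :
  v != 0 -> v \in pline x -> v \in pline y -> x = y.
Proof.
by move=> v0 vx vy; apply/val_inj; rewrite /= (plineE vx v0) (plineE vy v0).
Qed.

Lemma add_scale_neq0 (K : fieldType) (n : nat) (w q : 'rV[K]_n) (t : K) :
  w \notin <[q]>%VS -> w + t *: q != 0.
Proof.
apply: contraNneq => /eqP; rewrite addr_eq0 => /eqP ->.
by rewrite rpredN rpredZ ?memv_line.
Qed.

Lemma add_scale_line_inj (K : fieldType) (n : nat) (w q : 'rV[K]_n) (s t : K) :
  q != 0 -> w \notin <[q]>%VS -> w + s *: q \in <[w + t *: q]>%VS -> s = t.
Proof.
move=> q0 wq /vlineP[c e].
have {}e : (1 - c) *: w = (c * t - s) *: q.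
  rewrite !scalerBl scale1r -scalerA; apply/eqP; rewrite subr_eq addrAC.
  by rewrite -subr_eq opprK e scalerDr addrC.
have c1 : c = 1.
  apply/esym/eqP; rewrite -subr_eq0; apply: contraNT wq => c1.
  by rewrite -[w]scale1r -(mulVf c1) -scalerA e !rpredZ ?memv_line.
move/esym/eqP: e; rewrite c1 subrr scale0r scaler_eq0 (negbTE q0) orbF mul1r.
by rewrite subr_eq0 => /eqP.
Qed.

Lemma pspan_pair (K : fieldType) (r : nat) (x y z : pspace K r)
    (u v : 'rV[K]_r.+1) :
  u \in pline x -> v \in pline y -> u - v \in pline z -> u != v ->
  pspan [fset x; y]%fset z.
Proof.
move=> ux vy uvz uv W /= xyW; rewrite /plinear /=.
rewrite (plineE uvz) ?subr_eq0 // -memvE.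
have /subvP xW := xyW x (fset21 x y).
have /subvP yW := xyW y (fset22 x y).
exact: rpredB (xW _ ux) (yW _ vy).
Qed.

Lemma card_fset_sep_all (K : choiceType) (S : {fset K}) (P : pred K) :
  {in S, forall z, P z} -> #|` [fset z in S | P z]%fset| = #|` S|.
Proof.
move=> SP; congr #|` _|; apply/fsetP => z; rewrite !inE /=.
by apply: andb_idr; apply: SP.
Qed.

Lemma card_fset_sep_none (K : choiceType) (S : {fset K}) (P : pred K) :
  {in S, forall z, ~~ P z} -> #|` [fset z in S | P z]%fset| = 0%N.
Proof.
move=> SP; apply/eqP; rewrite cardfs_eq0; apply/eqP/fsetP => z.
by rewrite !inE /=; apply/negP => /andP[/SP/negP].
Qed.

(** * Complex conjugation, real points and labels *)

Section Real.
Variable R : realType.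
Local Notation C := R[i].
Local Notation conjv := (map_mx (@conjc R)).

(** For any representative [v], the vector [v + conjv v] is real and lies on the line [q]. If it is
    zero, then [v] is purely imaginary and ['i v] is real. *)
Lemma real_representative (r : nat) (q : pspace C r) : preal q ->
  exists v, [/\ v \in pline q, v != 0 & conjv v = v].
Proof.
move=> q_real; set v := vpick q; have vq : v \in pline q := memv_pick q.
have v0 : v != 0 := vpick_pline_neq0 q.
have cq : conjv v \in pline q.
  by rewrite -[in pline q]q_real (pconjE vq v0) memv_line.
have conjvK u : conjv (conjv u) = u :> 'rV[C]_r.+1.
  by apply/matrixP => i j; rewrite !mxE conjcK.
have [e|ne] := eqVneq (v + conjv v) 0; last first.
  exists (v + conjv v); split=> //; first exact: rpredD.
  by rewrite map_mxD conjvK addrC.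
exists ('i%C *: v); split; first exact: rpredZ.
  by rewrite scaler_eq0 negb_or v0 andbT eq_complex /= oner_eq0 andbF.
move/eqP: e; rewrite addrC addr_eq0 => /eqP e.
rewrite map_mxZ e scalerN -scaleNr; congr (_ *: _).
by apply/eqP; rewrite eq_complex /= oppr0 opprK !eqxx.
Qed.

Lemma pconj_ppoint (r : nat) (v : 'rV[C]_r.+1) (v0 : v != 0)
    (cv0 : conjv v != 0) : pconj (ppoint v0) = ppoint cv0.
Proof. exact/val_inj/(@pconjE _ _ (ppoint v0) v (memv_line v) v0). Qed.

Section Labels.
Variables (r : nat) (X : set (pspace C r)).

Lemma has_label_point q : preal q -> X q -> has_label X q 0 1.
Proof.
move=> q_real Xq; exists [fset q]%fset; split; last first.
  by split=> // W qW; exact: qW q (fset11 q).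
split; first split=> //; first by move/fsetP/(_ q); rewrite fset11.
  by move=> x /fset1P ->.
split; last by rewrite cardfs1.
  apply/seteqP; split=> [_ [x /fset1P -> <-]|x /fset1P ->].
    by rewrite q_real; exact: fset11.
  by exists q => //; exact: fset11.
rewrite card_fset_sep_all ?cardfs1 // => x /fset1P ->; exact: mem_set.
Qed.

Lemma has_label_real_pair q x y : x != y -> X x -> X y -> preal x -> preal y ->
  preal q -> pspan [fset x; y]%fset q -> has_label X q 0 2.
Proof.
move=> xy Xx Xy x_real y_real q_real q_span.
exists [fset x; y]%fset; split; last by [].
split; first split=> //; first by move/fsetP/(_ x); rewrite fset21.
  by move=> z /fset2P[] ->.
split; last by rewrite cardfs2 xy.
  apply/seteqP; split=> [_ [z /fset2P[] -> <-]|z /fset2P[] ->].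
  - by rewrite x_real; exact: fset21.
  - by rewrite y_real; exact: fset22.
  - by exists x => //; exact: fset21.
  - by exists y => //; exact: fset22.
rewrite card_fset_sep_all ?cardfs2 ?xy // => z /fset2P[] ->; exact: mem_set.
Qed.

Lemma has_label_conj_pair q x y : x != y -> X x -> X y ->
  pconj x = y -> pconj y = x ->
  preal q -> pspan [fset x; y]%fset q -> has_label X q 1 0.
Proof.
move=> xy Xx Xy x_conj y_conj q_real q_span.
exists [fset x; y]%fset; split; last by [].
split; first split=> //; first by move/fsetP/(_ x); rewrite fset21.
  by move=> z /fset2P[] ->.
split; last by rewrite cardfs2 xy.
  apply/seteqP; split=> [_ [z /fset2P[] -> <-]|z /fset2P[] ->].
  - by rewrite x_conj; exact: fset22.
  - by rewrite y_conj; exact: fset21.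
  - by exists y => //; exact: fset22.
  - by exists x => //; exact: fset21.
(* A real point of the pair would equal its conjugate, which is the other point. *)
rewrite card_fset_sep_none // => z /fset2P[] ->; apply/negP => /set_mem[_];
  by rewrite /preal /= ?x_conj ?y_conj => e; rewrite e eqxx in xy.
Qed.

End Labels.

(** * Real hypersurfaces: labels from roots, and containment in a hyperplane *)

Section Hypersurface.
Variables (r d : nat) (f : {mpoly C[r.+1]}).
Hypotheses (d_gt0 : (0 < d)%N) (f_homog : f \is d.-homog).
Hypothesis f_real : defined_over_R (zero_locus [set f]).

Lemma zero_locus_ppoint (v : 'rV[C]_r.+1) (v0 : v != 0) :
  zero_locus [set f] (ppoint v0) <-> f.@[v ord0] = 0.
Proof.
split=> [/(_ f erefl v)|fv _ /= ->]; first by apply; rewrite memv_line.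
by apply: (vanishes_ppoint f_homog) fv; rewrite //= memv_line.
Qed.

(** The coefficients of [f] may be non-real, so the argument goes through the zero locus, which
    conjugation preserves. *)
Lemma meval_conj (v : 'rV[C]_r.+1) : v != 0 ->
  f.@[v ord0] = 0 -> f.@[(conjv v) ord0] = 0.
Proof.
move=> v0 fv; have cv0 : conjv v != 0 by rewrite map_mx_eq0.
apply/(zero_locus_ppoint cv0); rewrite -(pconj_ppoint v0) -f_real.
by exists (ppoint v0) => //; apply/zero_locus_ppoint.
Qed.

(** Two distinct points [w + a v] and [w + b v] span [q], as their difference is [(a - b) v].
    Conjugation sends the parameter [a] to [conjc a], so a non-real root is paired with its own
    conjugate, and two real roots with each other. *)
Lemma has_label_distinct_roots (q : pspace C r) (v w : 'rV[C]_r.+1) (s t : C) :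
  preal q -> v \in pline q -> conjv v = v -> conjv w = w ->
  f.@[v ord0] != 0 -> s != t ->
  root (line_poly f w v) s -> root (line_poly f w v) t ->
  has_label (zero_locus [set f]) q 1 0 \/ has_label (zero_locus [set f]) q 0 2.
Proof.
move=> q_real vq v_real w_real fv st.
rewrite !rootE !horner_line_poly => /eqP fs /eqP ft.
have v0 : v != 0.
  apply: contraNneq fv => ->.
  by rewrite -(scale0r 0) (dhomog_mevalZ _ _ f_homog) expr0n gtn_eqF ?mul0r.
(* If [w = c v], then [f(w + a v) = (c + a)^d f(v)] vanishes only at [a = - c], against [s != t]. *)
have wv : w \notin <[v]>%VS.
  apply/negP => /vlineP[c wE]; move: fs ft st; rewrite wE -!scalerDl.
  rewrite !(dhomog_mevalZ _ _ f_homog) => /eqP + /eqP.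
  rewrite !mulf_eq0 (negbTE fv) !orbF !expf_eq0 d_gt0 /=.
  by move=> /eqP <- /eqP/addrI ->; rewrite eqxx.
have p0 := add_scale_neq0 _ wv.
have conj_p a : conjv (w + a *: v) = w + conjc a *: v.
  by rewrite map_mxD map_mxZ v_real w_real.
have Xp a : f.@[(w + a *: v) ord0] = 0 -> zero_locus [set f] (ppoint (p0 a)).
  by move/zero_locus_ppoint; apply.
have pconj_p a : pconj (ppoint (p0 a)) = ppoint (p0 (conjc a)).
  apply: (pspace_eq (p0 (conjc a))); rewrite ?(pconjE (v := w + a *: v)) //=;
    by rewrite ?conj_p memv_line.
have p_neq a b : a != b -> ppoint (p0 a) != ppoint (p0 b).
  apply: contraNneq => /(congr1 (@pline _ _)) /= e; apply/eqP.
  by apply: (add_scale_line_inj v0 wv); rewrite -e memv_line.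
have q_span a b : a != b -> pspan [fset ppoint (p0 a); ppoint (p0 b)]%fset q.
  have diffE : w + a *: v - (w + b *: v) = (a - b) *: v.
    by rewrite opprD addrACA subrr add0r scalerBl.
  move=> ab; apply: (pspan_pair (u := w + a *: v) (v := w + b *: v)).
  - by rewrite /= memv_line.
  - by rewrite /= memv_line.
  - by rewrite diffE rpredZ.
  - by rewrite -subr_eq0 diffE scaler_eq0 subr_eq0 negb_or ab v0.
have conj_label a : f.@[(w + a *: v) ord0] = 0 -> conjc a != a ->
    has_label (zero_locus [set f]) q 1 0.
  move=> fa; rewrite eq_sym => a_conj.
  apply: (has_label_conj_pair (p_neq _ _ a_conj)) (q_span _ _ a_conj) => //.
  - exact: Xp.
  - by apply: Xp; rewrite -conj_p meval_conj.
  - by rewrite pconj_p conjcK.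
have [s_real|/(conj_label _ fs)] := eqVneq (conjc s) s; last by left.
have [t_real|/(conj_label _ ft)] := eqVneq (conjc t) t; last by left.
right; apply: (has_label_real_pair (p_neq _ _ st)) (q_span _ _ st) => //.
- exact: Xp.
- exact: Xp.
- by rewrite /preal /= pconj_p s_real.
- by rewrite /preal /= pconj_p t_real.
Qed.

Lemma power_on_real_vectors (v : 'rV[C]_r.+1) :
  (forall w : 'rV[C]_r.+1, conjv w = w ->
     f.@[w ord0] * (d%:R * f.@[v ord0]) ^+ d =
     f.@[v ord0] * dir_deriv f v w ^+ d) ->
  forall w : 'rV[C]_r.+1, f.@[w ord0] * (d%:R * f.@[v ord0]) ^+ d =
            f.@[v ord0] * dir_deriv f v w ^+ d.
Proof.
(* Both sides are polynomials in t along the line re + t im. *)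
move=> f_pow w.
pose re : 'rV[C]_r.+1 := map_mx (fun z => (complex.Re z)%:C%C) w.
pose im : 'rV[C]_r.+1 := map_mx (fun z => (complex.Im z)%:C%C) w.
have re_real : conjv re = re by apply/matrixP => i j; rewrite !mxE conjc_real.
have im_real : conjv im = im by apply/matrixP => i j; rewrite !mxE conjc_real.
have -> : w = re + 'i%C *: im.
  by apply/matrixP => i j; rewrite !mxE -complexE.
have linE t : dir_deriv f v (re + t *: im) =
    ((dir_deriv f v re)%:P + dir_deriv f v im *: 'X).[t].
  by rewrite linearD linearZ /= !hornerE mulrC.
have : line_poly f re im * ((d%:R * f.@[v ord0]) ^+ d)%:P =
    (f.@[v ord0])%:P * ((dir_deriv f v re)%:P + dir_deriv f v im *: 'X) ^+ d.
  (* For natural [k] the vector [re + k im] is real, so the hypothesis applies; evaluating at ['i]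
     afterwards recovers [w]. *)
  apply: poly_eq_nat => k; rewrite !hornerM !hornerC horner_exp -linE.
  rewrite horner_line_poly; apply: f_pow.
  by rewrite map_mxD map_mxZ re_real im_real /= conjc_nat.
move/(congr1 (horner^~ 'i%C)).
by rewrite !hornerM !hornerC horner_exp -linE horner_line_poly.
Qed.

(** The hyperplane is the kernel of the linear form [D]: where [f] vanishes, the identity forces
    [D w ^+ d = 0]. Euler's identity gives [D v != 0], so the kernel has codimension 1 by
    rank-nullity. *)
Lemma degenerate_of_power (v : 'rV[C]_r.+1) :
  f.@[v ord0] != 0 ->
  (forall w : 'rV[C]_r.+1, f.@[w ord0] * (d%:R * f.@[v ord0]) ^+ d =
             f.@[v ord0] * dir_deriv f v w ^+ d) ->
  exists W : {vspace 'rV[C]_r.+1},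
    \dim W = r /\ zero_locus [set f] `<=` plinear W.
Proof.
move=> fv f_pow; pose D : 'Hom('rV[C]_r.+1, C^o) := linfun (dir_deriv f v).
have DE w : D w = dir_deriv f v w by rewrite lfunE.
have Dv : D v != 0.
  by rewrite DE (dir_deriv_self _ f_homog) mulf_neq0 ?pnatr_eq0 -?lt0n.
exists (lker D); split.
  have := limg_ker_dim D fullv; rewrite capfv dimvf /dim /= mul1n.
  suff -> : \dim (limg D) = 1%N by rewrite addn1 => -[].
  apply/eqP; rewrite eqn_leq (leq_trans (dimvS (subvf _))) ?dimvf //=.
  rewrite lt0n dimv_eq0; apply: contraNneq Dv => D0.
  by rewrite -memv0 -D0 memv_img ?memvf.
move=> x /(_ f erefl) fx; apply/subvP => w /fx fw.
rewrite memv_ker DE; apply/eqP; have /esym/eqP := f_pow w.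
by rewrite fw mul0r mulf_eq0 (negbTE fv) expf_eq0 d_gt0 => /eqP.
Qed.

End Hypersurface.
End Real.

Theorem proposition1p2 (R : realType) (n : nat)
    (X : set (pspace R[i] n.+1))
    (X_integral : integral_subvariety X)
    (X_hypersurface : hypersurface X)
    (X_nondegenerate : nondegenerate_subvariety X)
    (X_real : defined_over_R X)
    (q : pspace R[i] n.+1)
    (q_real : preal q) :
  has_label X q 1 0 \/ has_label X q 0 2 \/ has_label X q 0 1.
Proof.
have [d [f [d_gt0 _ f_homog XE]]] := X_hypersurface; subst X.
have [v [vq v0 v_real]] := real_representative q_real.
have [fv|fv] := eqVneq f.@[v ord0] 0.
  right; right; apply: has_label_point => // _ /= ->.
  exact: (vanishes_ppoint f_homog vq).
have [[w [s [t [w_real st fs ft]]]]|no_pair] :=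
    pselect (exists w s t, [/\ map_mx (@conjc R) w = w, s != t,
      root (line_poly f w v) s & root (line_poly f w v) t]).
  by have [] := has_label_distinct_roots d_gt0 f_homog X_real q_real vq v_real
    w_real fv st fs ft; [left|right; left].
case: X_nondegenerate; apply: (degenerate_of_power d_gt0 f_homog fv).
(* The failure of [no_pair] to produce two roots concerns real [w] only, hence the passage through
   real vectors. *)
apply: power_on_real_vectors => w w_real.
apply: (dhomog_single_root_power f_homog fv) => s t fs ft.
by apply/eqP; apply: contra_notT no_pair => st; exists w, s, t.
Qed.
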